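(* Let $T>0$, let $U\subset\mathbb{R}^m$ be closed and nonempty, let $X\subset C^0(\mathbb{R}^n\times U;\mathbb{R}^n)$ be compact with respect to $\|\cdot\|_\infty$, and let $\pi^N$ and $\pi^\infty$ be two probability distributions on $X$. Let $\ell:\mathbb{R}^n\times U\to\mathbb{R}$ and $h:\mathbb{R}^n\to\mathbb{R}$ be the running and terminal costs, and let $V_{\pi^N}$, $V_{\pi^\infty}$ be the value functions of the averaged optimal control problems associated with $\pi^N$ and $\pi^\infty$ respectively (with the same $T,U,X,\ell,h$), as defined in the context. Assume: (i) there exists a constant $L_f>0$ such that $$|f(x,u)-f(y,u)|\le L_f|x-y|\qquad\text{for each } f\in\operatorname{supp}(\pi^\infty),\ x,y\in\mathbb{R}^n,\ u\in U;$$ (ii) $\ell$ and $h$ are Lipschitz continuous in the first argument, with constants $L_\ell$ and $L_h$ respectively, i.e. $|\ell(x,u)-\ell(y,u)|\le L_\ell|x-y|$ and $|h(x)-h(y)|\le L_h|x-y|$ for all $x,y\in\mathbb{R}^n$, $u\in U$. Then $$\|V_{\pi^N}-V_{\pi^\infty}\|_\infty\le C(L_f,L_\ell,L_h,T)\,W_1(\pi^N,\pi^\infty),$$ where the sup norm is over $[0,T]\times\mathbb{R}^n$ and $C(L_f,L_\ell,L_h,T)$ is a constant which depends only on the Lipschitz constants $L_f,L_\ell,L_h$ and on $T$.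
   Context: Notation: $|\cdot|$ is the Euclidean norm and $\|\cdot\|_\infty$ is the sup norm over the domain of the function. $X$ is a compact metric space for the distance $\|g-f\|_\infty$ (in particular this is finite for $f,g\in X$), and probability distributions on $X$ are Borel probability measures. Wasserstein distance: for probability distributions $\pi,\pi'$ on $X$, $$W_1(\pi,\pi')=\inf_{\gamma\in\Gamma(\pi,\pi')}\int_{X\times X}\|g-f\|_\infty\,d\gamma(g,f),$$ where $\Gamma(\pi,\pi')$ is the set of probability measures on $X\times X$ with marginals $\pi$ and $\pi'$. Averaged optimal control problem (with uncertain dynamics) associated with a probability distribution $\pi$ on $X$: for $s\in[0,T]$ let $\mathcal{U}_s=\{u:[s,T]\to U \text{ measurable}\}$ be the set of admissible controls. For $g\in X$, $x_0\in\mathbb{R}^n$, $u\in\mathcal{U}_s$, let $x^g$ denote the solution of $$\dot x^g(t)=g(x^g(t),u(t)),\quad t\in[s,T],\qquad x^g(s)=x_0,$$ i.e. the (absolutely continuous) solution of $x^g(t)=x_0+\int_s^t g(x^g(\tau),u(\tau))\,d\tau$. The cost functional is $$J_{\pi,s,x_0}[u]=\int_X\Big[\int_s^T\ell(x^g(t),u(t))\,dt+h(x^g(T))\Big]d\pi(g),$$ where the same control $u$ is applied to every dynamics $g\in X$, and the value function is $$V_\pi(s,x_0)=\inf_{u\in\mathcal{U}_s}J_{\pi,s,x_0}[u],\qquad (s,x_0)\in[0,T]\times\mathbb{R}^n.$$ Standing assumptions: for every $g\in X$, every $(s,x_0)$ and every $u\in\mathcal{U}_s$ the Cauchy problem above has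 a unique solution on $[s,T]$; the cost functionals are well defined and finite (all integrals appearing in them make sense), and the value functions are real-valued. *)

(* Defs.v *)
From HB Require Import structures.
From mathcomp Require Import all_boot all_order all_algebra.
From mathcomp Require Import all_classical all_reals all_analysis.

Set Implicit Arguments.
Unset Strict Implicit.
Unset Printing Implicit Defensive.

Import Order.TTheory GRing.Theory Num.Theory.
Import numFieldNormedType.Exports.

Local Open Scope classical_set_scope.
Local Open Scope ring_scope.

(* Euclidean norm; the library norm on matrices is the sup norm of the entries
   (the two induce the same topology and the same uniform structure). *)
Definition enorm (R : realType) (n : nat) (x : 'rV[R]_n) : R :=
  Num.sqrt (\sum_(i < n) x ord0 i ^+ 2).

(* Maps R^n x U -> R^n, [U] being seen as a subtype of R^m with the induced
   topology. The space carries the topology of uniform convergence, i.e. that of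
   the (possibly infinite) distance [sup_dist] below. *)
Notation dynamics R n U := {uniform ('rV[R]_n * set_type U) -> 'rV[R]_n}.

Definition sup_dist (R : realType) (n m : nat) (U : set 'rV[R]_m)
    (g f : dynamics R n U) : \bar R :=
  ereal_sup (range (fun z => (enorm (g z - f z))%:E)).

(* [X] as a metric space on its own. Measurable spaces of the library are
   pointed, whence the nonemptiness proof (no probability exists on the empty
   set). *)
Definition dyn_space (R : realType) (n m : nat) (U : set 'rV[R]_m)
  (X : set (dynamics R n U)) (X0 : X !=set0) : Type := set_type X.
Arguments dyn_space {R n m U X} X0.

HB.instance Definition _ (R : realType) (n m : nat) (U : set 'rV[R]_m)
    (X : set (dynamics R n U)) (X0 : X !=set0) :=
  Uniform.copy (dyn_space X0) (set_type X).
HB.instance Definition _ (R : realType) (n m : nat) (U : set 'rV[R]_m)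
    (X : set (dynamics R n U)) (X0 : X !=set0) :=
  isPointed.Build (dyn_space X0)
    (SigSub (mem_set (projT2 (cid X0))) : set_type X).

Definition dyn_fun (R : realType) (n m : nat) (U : set 'rV[R]_m)
    (X : set (dynamics R n U)) (X0 : X !=set0) (g : dyn_space X0) :
    'rV[R]_n * set_type U -> 'rV[R]_n :=
  set_val (g : set_type X).
Arguments dyn_fun {R n m U X} X0 g.

Notation borel X0 := (g_sigma_algebraType (@open (dyn_space X0))).

Definition supp (R : realType) (n m : nat) (U : set 'rV[R]_m)
    (X : set (dynamics R n U)) (X0 : X !=set0) (pi : probability (borel X0) R) :
    set (dyn_space X0) :=
  [set f | forall A : set (dyn_space X0), open A -> A f -> (0 < pi A)%E].

Definition couplings (R : realType) (n m : nat) (U : set 'rV[R]_m)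
    (X : set (dynamics R n U)) (X0 : X !=set0)
    (pi pi' : probability (borel X0) R) :
    set (probability (borel X0 * borel X0)%type R) :=
  [set gamma | forall A : set (borel X0), measurable A ->
     gamma (A `*` setT) = pi A /\ gamma (setT `*` A) = pi' A].

Definition W1 (R : realType) (n m : nat) (U : set 'rV[R]_m)
    (X : set (dynamics R n U)) (X0 : X !=set0)
    (pi pi' : probability (borel X0) R) : \bar R :=
  ereal_inf [set (\int[gamma]_z sup_dist (dyn_fun X0 z.1) (dyn_fun X0 z.2))%E
            | gamma in couplings pi pi'].

(* The real line with the sigma-algebra of Lebesgue measurable sets (the library
   type [R] itself carries the Borel sets). *)
Notation lebR R := (caratheodory_type (@wlength R idfun)^*%mu).
Notation leb := completed_lebesgue_measure.

(* [u] is total, but only its values on [s, T] matter below. Measurability for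
   the Borel sigma-algebra of R^m is measurability of each coordinate. *)
Definition admissible (R : realType) (m : nat) (U : set 'rV[R]_m) (T s : R) :
    set (R -> set_type U) :=
  [set u : R -> set_type U | forall j : 'I_m,
     measurable_fun (`[s, T] : set (lebR R))
       (fun t : lebR R => (set_val (u t) : 'rV[R]_m) ord0 j : R)].

(* [x] is only constrained on [s, T]. The integrability clause makes the
   vector-valued integral meaningful and [x] absolutely continuous. *)
Definition is_solution (R : realType) (n m : nat) (U : set 'rV[R]_m) (T : R)
    (g : 'rV[R]_n * set_type U -> 'rV[R]_n) (s : R) (x0 : 'rV[R]_n)
    (u : R -> set_type U) (x : R -> 'rV[R]_n) : Prop :=
  (forall i, leb.-integrable (`[s, T] : set (lebR R))
               (fun t => (g (x t, u t) ord0 i)%:E)) /\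
  (forall t, t \in `[s, T] -> forall i,
     x t ord0 i = x0 ord0 i +
       \int[leb]_(r in (`[s, t] : set (lebR R))) (g (x r, u r) ord0 i)).

Definition well_posed (R : realType) (n m : nat) (U : set 'rV[R]_m) (T : R)
    (g : 'rV[R]_n * set_type U -> 'rV[R]_n) : Prop :=
  forall s x0 u, s \in `[0, T] -> @admissible R m U T s u ->
    (exists x, is_solution T g s x0 u x) /\
    (forall x y, is_solution T g s x0 u x -> is_solution T g s x0 u y ->
       forall t, t \in `[s, T] -> x t = y t).

(* The solution x^g, unique on [s, T] under [well_posed] *)
Definition traj (R : realType) (n m : nat) (U : set 'rV[R]_m) (T : R)
    (g : 'rV[R]_n * set_type U -> 'rV[R]_n) (s : R) (x0 : 'rV[R]_n)
    (u : R -> set_type U) : R -> 'rV[R]_n :=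
  xget (fun=> x0) [set x | is_solution T g s x0 u x].

Definition running_cost (R : realType) (n m : nat) (U : set 'rV[R]_m) (T : R)
    (l : 'rV[R]_n -> set_type U -> R)
    (g : 'rV[R]_n * set_type U -> 'rV[R]_n) (s : R) (x0 : 'rV[R]_n)
    (u : R -> set_type U) (t : R) : \bar R :=
  (l (traj T g s x0 u t) (u t))%:E.

Definition traj_cost (R : realType) (n m : nat) (U : set 'rV[R]_m) (T : R)
    (l : 'rV[R]_n -> set_type U -> R) (h : 'rV[R]_n -> R)
    (g : 'rV[R]_n * set_type U -> 'rV[R]_n) (s : R) (x0 : 'rV[R]_n)
    (u : R -> set_type U) : \bar R :=
  ((\int[leb]_(t in (`[s, T] : set (lebR R))) running_cost T l g s x0 u t)
   + (h (traj T g s x0 u T))%:E)%E.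

Definition cost (R : realType) (n m : nat) (U : set 'rV[R]_m)
    (X : set (dynamics R n U)) (X0 : X !=set0) (pi : probability (borel X0) R)
    (T : R) (l : 'rV[R]_n -> set_type U -> R) (h : 'rV[R]_n -> R)
    (s : R) (x0 : 'rV[R]_n) (u : R -> set_type U) : \bar R :=
  (\int[pi]_g traj_cost T l h (dyn_fun X0 g) s x0 u)%E.

Definition cost_well_defined (R : realType) (n m : nat) (U : set 'rV[R]_m)
    (X : set (dynamics R n U)) (X0 : X !=set0) (pi : probability (borel X0) R)
    (T : R) (l : 'rV[R]_n -> set_type U -> R) (h : 'rV[R]_n -> R) : Prop :=
  forall s x0 u, s \in `[0, T] -> @admissible R m U T s u ->
    (forall g : dyn_space X0,
       leb.-integrable (`[s, T] : set (lebR R))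
         (running_cost T l (dyn_fun X0 g) s x0 u)) /\
    pi.-integrable [set: borel X0]
      (fun g => traj_cost T l h (dyn_fun X0 g) s x0 u).

Definition value (R : realType) (n m : nat) (U : set 'rV[R]_m)
    (X : set (dynamics R n U)) (X0 : X !=set0) (pi : probability (borel X0) R)
    (T : R) (l : 'rV[R]_n -> set_type U -> R) (h : 'rV[R]_n -> R)
    (s : R) (x0 : 'rV[R]_n) : \bar R :=
  ereal_inf [set cost pi T l h s x0 u | u in @admissible R m U T s].

Definition sup_norm (R : realType) (n : nat) (T : R)
    (F : R -> 'rV[R]_n -> \bar R) : \bar R :=
  ereal_sup [set `|F p.1 p.2|%E | p in `[0, T] `*` setT].

(* Main.v *)
From HB Require Import structures.
Require Import Defs.
From mathcomp Require Import all_boot all_order all_algebra.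
From mathcomp Require Import ring lra.
From mathcomp Require Import finmap.
From mathcomp Require Import all_classical all_reals all_analysis.
From mathcomp Require Import measurable_realfun.
Import Order.TTheory GRing.Theory Num.Theory.
Import numFieldNormedType.Exports.
Local Open Scope classical_set_scope.
Local Open Scope ring_scope.

Set Implicit Arguments.
Unset Strict Implicit.
Unset Printing Implicit Defensive.

(** Applying one control to two dynamics g and f, with f Lipschitz in the state,
    gives trajectories that stay within a multiple of the distance between g and
    f: the velocities differ by at most that distance plus [Lf] times the gap
    between the trajectories, and Gronwall's argument closes the estimate
    ([gronwall_enorm], [solution_stability]). Since the costs are Lipschitz in
    the state, the cost of the control is Lipschitz in the dynamics, at every f
    in the support of [pioo] and with a constant that does not depend on the
    control, the initial point or the dimension ([traj_cost_stability]).

    Integrating this against a coupling gamma of [piN] and [pioo] bounds the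
    difference of the two averaged costs of a control by that constant times the
    transport cost of gamma ([coupling_bound]); the pairs whose second component
    lies outside the support are gamma-null ([compl_supp_negligible]). The bound
    is uniform in the control, so it passes to the infima over the controls
    ([abse_ereal_infB_le]), and finally to the infimum over the couplings. *)

(** * The support of a probability on a compact space of dynamics *)

(** For f a countable base of the uniformity and each n, finitely many balls for
    a symmetric half of f n cover X; the traces on X of all these balls form the
    countable base. *)
Lemma compact_set_type_second_countable (T : uniformType) (X : set T) :
  X !=set0 -> countable_uniformity T -> compact X ->
  second_countable (T := set_type X).
Proof.
move=> [x0 _] /countable_uniformityP[f fsub entf] cX.
pose E n := split_ent (f n) `&` ((split_ent (f n))^-1)%relation.
have entE n : entourage (E n).
  by apply: filterI; [|apply: entourage_inv]; exact: entourage_split_ent.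
pose O n (x : T) := ((xsection (E n) x)°)%classic : set T.
have OE n x y : O n x y -> E n (x, y).
  by move=> /interior_subset/xsectionP.
have h n : finite_subset_cover X (O n) X.
  (* Compactness is characterized by covers on pointed spaces. *)
  pose pT : puniformType := HB.pack T (isPointed.Build T x0).
  have : cover_compact (X : set pT) by rewrite -compact_cover.
  apply.
  - by move=> x _; exact: open_interior.
  - by move=> x Xx; exists x => //; rewrite /O /interior; exact: nbhs_entourage.
have /choice[D DP] : forall n, exists D : {fset T},
    {subset D <= X} /\ X `<=` cover [set` D] (O n).
  by move=> n; have [D DX XD] := h n; exists D.
pose trace n x : set (set_type X) := set_val @^-1` O n x.
pose B := \bigcup_n (trace n @` [set` D n]).
exists B; [|split].
- apply: bigcup_countable => // n _; apply: finite_set_countable.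
  exact/finite_image/finite_fset.
- by move=> ? [n _ [x _ <-]]; exists (O n x) => //; exact: open_interior.
- move=> x V /nbhsP[A [A' entA' A'A] xA].
  have [N fN] := fsub _ entA'.
  have Xx : X (set_val x) by apply: set_mem; exact: valP.
  have [w wD Ow] := (DP N).2 _ Xx.
  exists (set_val @^-1` O N w); first by split=> //; exists N => //; exists w.
  move=> z Oz; apply/xA/xsectionP/A'A; apply: fN => /=.
  apply: (entourage_split w); first exact: entf.
    by have [] := OE _ _ _ Ow.
  by have [] := OE _ _ _ Oz.
Qed.

Lemma dyn_countable_uniformity (R : realType) (n m : nat) (U : set 'rV[R]_m) :
  countable_uniformity (dynamics R n U).
Proof.
have /countable_uniformityP[f fsub entf] :=
  @countable_uniformity_metric R 'rV[R]_n.
apply/countable_uniformityP.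
exists (fun k => [set fg | forall t, [set: 'rV[R]_n * set_type U] t ->
                             f k (fg.1 t, fg.2 t)]) => [A|k].
  rewrite uniform_entourage => -[E entE EA].
  have [N fN] := fsub _ entE; exists N => -[g h] /= gh; apply: EA => t _ /=.
  exact/fN/gh.
by rewrite uniform_entourage; exists (f k).
Qed.

(** A countable base covers the union of all null open sets by countably many
    null ones; without it that union could have positive measure. *)
Lemma negligible_union_null_open (R : realType) (T : ptopologicalType)
    (mu : {measure set (g_sigma_algebraType (@open T)) -> \bar R}) :
  second_countable (T := T) ->
  mu.-negligible [set x | exists2 A : set T, open A & A x /\ mu A = 0%E].
Proof.
move=> [B cB [Bo Bb]].
pose B' := [set A | B A /\ mu A = 0%E].
have cB' : countable B'.
  by apply: sub_countable cB; apply: subset_card_le => A [].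
have sub : [set x | exists2 A : set T, open A & A x /\ mu A = 0%E] `<=`
    \bigcup_(A in B') A.
  move=> x [A oA [Ax A0]].
  have [V [BV Vx] VA] := Bb x A (open_nbhs_nbhs (conj oA Ax)).
  exists V => //; split => //; apply: (@subset_measure0 _ _ _ mu V A).
  - by apply: sub_sigma_algebra; exact: Bo.
  - by apply: sub_sigma_algebra.
  - exact: VA.
  - exact: A0.
apply: (@negligibleS _ (g_sigma_algebraType (@open T)) R mu _ _ sub).
have /pfcard_geP[->|/unsquash f] := cB'.
  by rewrite bigcup_set0; exact: negligible_set0.
apply: (@negligibleS _ (g_sigma_algebraType (@open T)) R mu (\bigcup_n f n)).
  move=> x [A B'A Ax]; have [n _ fA] := @surj _ _ _ _ f A B'A.
  by exists n => //; rewrite fA.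
apply: negligible_bigcup => n; have [Bf f0] : B' (f n) by exact: funS.
by apply/negligibleP => //; apply: sub_sigma_algebra; exact: Bo.
Qed.
Lemma dyn_space_second_countable (R : realType) (n m : nat) (U : set 'rV[R]_m)
    (X : set (dynamics R n U)) (X0 : X !=set0) :
  compact X -> second_countable (T := dyn_space X0).
Proof.
move=> cX; have sc := compact_set_type_second_countable X0
  (@dyn_countable_uniformity R n m U) cX.
by change (second_countable (T := set_type X)); exact: sc.
Qed.

Lemma compl_supp_negligible (R : realType) (n m : nat) (U : set 'rV[R]_m)
    (X : set (dynamics R n U)) (X0 : X !=set0) (pi : probability (borel X0) R) :
  compact X -> pi.-negligible (~` supp pi).
Proof.
move=> cX; have sc := dyn_space_second_countable X0 cX.
have := negligible_union_null_open pi sc.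
apply: (@negligibleS _ (borel X0) R pi).
move=> f /existsNP[A /not_implyP[oA /not_implyP[Af /negP piA]]].
exists A => //; split => //; apply/eqP.
by move: piA; rewrite lt0e measure_ge0 andbT negbK.
Qed.

(** * The Euclidean norm *)

Lemma enorm_ge0 (R : realType) (n : nat) (x : 'rV[R]_n) : 0 <= enorm x.
Proof. exact: sqrtr_ge0. Qed.

Lemma sqr_enorm (R : realType) (n : nat) (x : 'rV[R]_n) :
  enorm x ^+ 2 = \sum_(i < n) x ord0 i ^+ 2.
Proof. by rewrite sqr_sqrtr// sumr_ge0// => i _; exact: sqr_ge0. Qed.

Lemma le_abs_enorm (R : realType) (n : nat) (x : 'rV[R]_n) i :
  `|x ord0 i| <= enorm x.
Proof.
rewrite -sqrtr_sqr ler_sqrt; last by rewrite sumr_ge0// => j _; exact: sqr_ge0.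
by rewrite (bigD1 i)//= lerDl sumr_ge0// => j _; exact: sqr_ge0.
Qed.

Lemma enorm_le_sum (R : realType) (n : nat) (x : 'rV[R]_n) :
  enorm x <= \sum_(i < n) `|x ord0 i|.
Proof.
have [->|x0] := eqVneq (enorm x) 0; first by rewrite sumr_ge0.
have x_gt0 : 0 < enorm x by rewrite lt_neqAle eq_sym x0 enorm_ge0.
rewrite -(ler_pM2r x_gt0) -expr2 sqr_enorm mulr_suml ler_sum// => i _.
by rewrite -[leLHS]ger0_norm ?sqr_ge0// expr2 normrM ler_wpM2l// le_abs_enorm.
Qed.

Lemma enorm_CauchySchwarz (R : realType) (n : nat) (x y : 'rV[R]_n) :
  \sum_(i < n) x ord0 i * y ord0 i <= enorm x * enorm y.
Proof.
set a := enorm x; set b := enorm y.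
have [a0 b0] : 0 <= a /\ 0 <= b by rewrite !enorm_ge0.
have [ab0|ab0] := eqVneq (a * b) 0.
  rewrite ab0 big1// => i _; apply/eqP; rewrite -normr_le0 normrM -ab0.
  by rewrite ler_pM// le_abs_enorm.
have ab_gt0 : 0 < a * b by rewrite lt_neqAle eq_sym ab0 mulr_ge0.
have : \sum_(i < n) (2 * (a * b) * (x ord0 i * y ord0 i)) <=
       \sum_(i < n) (x ord0 i ^+ 2 * b ^+ 2 + y ord0 i ^+ 2 * a ^+ 2).
  (* Termwise, this is 0 <= (x_i b - y_i a)^2. *)
  apply: ler_sum => i _; rewrite -subr_ge0.
  have -> : x ord0 i ^+ 2 * b ^+ 2 + y ord0 i ^+ 2 * a ^+ 2 -
            2 * (a * b) * (x ord0 i * y ord0 i) =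
            (x ord0 i * b - y ord0 i * a) ^+ 2 by ring.
  exact: sqr_ge0.
rewrite -mulr_sumr big_split/= -!mulr_suml -!sqr_enorm -/a -/b.
have -> : a ^+ 2 * b ^+ 2 + b ^+ 2 * a ^+ 2 = 2 * (a * b) * (a * b) by ring.
by rewrite ler_pM2l// mulr_gt0.
Qed.

Lemma ler_enormD (R : realType) (n : nat) (x y : 'rV[R]_n) :
  enorm (x + y) <= enorm x + enorm y.
Proof.
have [->|xy0] := eqVneq (enorm (x + y)) 0; first by rewrite addr_ge0 ?enorm_ge0.
have xy_gt0 : 0 < enorm (x + y) by rewrite lt_neqAle eq_sym xy0 enorm_ge0.
rewrite -(ler_pM2l xy_gt0) -expr2 sqr_enorm mulrDr.
rewrite (_ : \sum_(i < n) _ = \sum_(i < n) (x + y) ord0 i * x ord0 i +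
                             \sum_(i < n) (x + y) ord0 i * y ord0 i).
  by rewrite lerD// enorm_CauchySchwarz.
by rewrite -big_split/=; apply: eq_bigr => i _; rewrite -mulrDr !mxE expr2.
Qed.

(** * Integrals of vector-valued functions *)

Lemma integrable_scale (d : measure_display) (S : measurableType d)
    (R : realType) (mu : {measure set S -> \bar R}) (A : set S) (c : R)
    (f : S -> R) :
  measurable A -> mu.-integrable A (fun t => (f t)%:E) ->
  mu.-integrable A (fun t => (c * f t)%:E).
Proof. by move=> mA fi; under eq_fun do rewrite EFinM; exact: integrableZl. Qed.

Lemma Rintegral_sum (d : measure_display) (S : measurableType d) (R : realType)
    (mu : {measure set S -> \bar R}) (A : set S) (I : Type) (r : seq I)
    (f : I -> S -> R) :
  measurable A ->
  (forall i, mu.-integrable A (EFin \o f i)) ->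
  mu.-integrable A (fun t => (\sum_(i <- r) f i t)%:E) /\
  \int[mu]_(t in A) (\sum_(i <- r) f i t) =
    \sum_(i <- r) \int[mu]_(t in A) f i t.
Proof.
move=> mA fi.
have int_sum : forall r, mu.-integrable A (fun t => (\sum_(i <- r) f i t)%:E).
  move=> r'; rewrite (_ : (fun t => _) =
      (fun t => (\sum_(i <- r') (EFin \o f i) t)%E)).
    exact: integrable_sum.
  by apply/funext => t; rewrite sumEFin.
split=> //; elim: r => [|i r IH].
  under eq_Rintegral do rewrite big_nil.
  by rewrite Rintegral_cst// mul0r big_nil.
rewrite big_cons -IH -RintegralD//; last exact: int_sum.
by apply: eq_Rintegral => t _; rewrite big_cons.
Qed.

(** Estimating the coordinates of y one by one would lose a factor depending on
    the dimension. Instead, |y|^2 is the integral of the inner product of y with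
    w, hence at most |y| times the integral of phi. The majorant phi spares the
    measurability of the norm of w. *)
Lemma enorm_Rintegral_le (d : measure_display) (S : measurableType d)
    (R : realType) (mu : {measure set S -> \bar R}) (n : nat) (A : set S)
    (w : S -> 'rV[R]_n) (phi : S -> R) (y : 'rV[R]_n) :
  measurable A ->
  (forall i, mu.-integrable A (fun t => (w t ord0 i)%:E)) ->
  (forall i, y ord0 i = \int[mu]_(t in A) w t ord0 i) ->
  mu.-integrable A (EFin \o phi) ->
  (forall t, A t -> enorm (w t) <= phi t) ->
  enorm y <= \int[mu]_(t in A) phi t.
Proof.
move=> mA wi yE phii wphi.
have [->|y0] := eqVneq (enorm y) 0.
  by apply: Rintegral_ge0 => t At; exact: le_trans (enorm_ge0 _) (wphi t At).
have y_gt0 : 0 < enorm y by rewrite lt_neqAle eq_sym y0 enorm_ge0.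
have ywi i : mu.-integrable A (fun t => (y ord0 i * w t ord0 i)%:E).
  exact: (integrable_scale _ mA (wi i)).
have [si sE] := @Rintegral_sum _ _ _ mu A _ (index_enum 'I_n)
  (fun i t => y ord0 i * w t ord0 i) mA ywi.
rewrite -(ler_pM2l y_gt0) -RintegralZl// -expr2 sqr_enorm.
rewrite (_ : \sum_(i < n) _ =
    \int[mu]_(t in A) (\sum_(i < n) y ord0 i * w t ord0 i)).
  apply: le_Rintegral => //.
    exact: (integrable_scale _ mA phii).
  move=> t At; apply: (le_trans (enorm_CauchySchwarz _ _)).
  by rewrite ler_wpM2l ?enorm_ge0// wphi.
rewrite sE; apply: eq_bigr => i _; rewrite RintegralZl//; last exact: wi.
by rewrite -yE expr2.
Qed.
(** * The completed Lebesgue measure *)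

Lemma measurable_leb (R : realType) (A : set R) :
  measurable A -> measurable (A : set (lebR R)).
Proof. by move=> mA; exact: sub_caratheodory. Qed.

Lemma measurable_fun_leb (R : realType) :
  measurable_fun [set: lebR R] (fun x : lebR R => x : R).
Proof. by move=> _ B mB; rewrite setTI; exact: measurable_leb. Qed.

(** The Lebesgue measure on Borel sets is the image of its completion by the
    identity, which gives access to the fundamental theorem of calculus, stated
    for the former. *)
Lemma ge0_integral_leb (R : realType) (A : set R) (f : R -> R) :
  measurable A -> measurable_fun A f -> (forall x, 0 <= f x) ->
  (\int[leb]_(x in (A : set (lebR R))) (f x)%:E =
   \int[lebesgue_measure]_(x in A) (f x)%:E)%E.
Proof.
move=> mA mf f0.
rewrite -[LHS](@ge0_integral_pushforward _ _ (lebR R) (measurableTypeR R) R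
  (fun x => x) (@measurable_fun_leb R) leb A (fun x => (f x)%:E))//.
- by apply/measurable_EFinP.
- by move=> x _; rewrite lee_fin.
Qed.

Lemma leb_itv (R : realType) (s t : R) : s <= t ->
  leb (`[s, t] : set (lebR R)) = (t - s)%:E.
Proof.
move=> st; have -> : leb (`[s, t] : set (lebR R)) =
    lebesgue_measure (`[s, t] : set R) by [].
rewrite lebesgue_measure_itv/= lte_fin.
by have [//|] := ltP s t; move: st; case: ltgtP => // -> _ _; rewrite subrr.
Qed.

Lemma continuous_expR_affine (R : realType) (k s : R) :
  continuous (fun r => expR (k * (r - s))).
Proof.
move=> x; apply: (@continuous_comp _ _ _ (fun r => k * (r - s)) expR).
  by apply: cvgMr; apply: cvgB; [exact: cvg_id|exact: cvg_cst].
exact: continuous_expR.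
Qed.

Lemma integral_leb_expR (R : realType) (k s t : R) : 0 < k -> s <= t ->
  (\int[leb]_(r in (`[s, t] : set (lebR R))) (expR (k * (r - s)))%:E =
   ((expR (k * (t - s)) - 1) / k)%:E)%E.
Proof.
move=> k0 st.
have dE (x : R) :
    is_derive x 1 (fun r => expR (k * (r - s)) / k) (expR (k * (x - s))).
  (* The instances for derivatives apply to this point-free form. *)
  have d1 : is_derive x 1 (k *: ((id : R -> R) - cst s)) k.
    by apply: is_derive_eq; rewrite subr0 /GRing.scale/= mulr1.
  have d2 : is_derive x 1 (k^-1 *: (expR \o (k *: ((id : R -> R) - cst s))))
      (expR (k * (x - s))).
    apply: is_derive_eq; rewrite /GRing.scale/= mulrCA mulVf ?mulr1// gt_eqF//.
  move: d2; congr (is_derive _ _ _ _).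
  by apply/funext => r; rewrite /GRing.scale/= mulrC.
pose f r := expR (k * (r - s)).
have cf : continuous f by exact: continuous_expR_affine.
rewrite (@ge0_integral_leb _ `[s, t]%classic f)//; last 2 first.
  by apply: measurable_funTS; exact: continuous_measurable_fun.
  by move=> x; exact: expR_ge0.
move: st; rewrite le_eqVlt => /predU1P[->|st].
  by rewrite set_itv1 integral_set1 subrr mulr0 expR0 subrr mul0r.
have cF : continuous (fun r => expR (k * (r - s)) / k).
  move=> x; apply/differentiable_continuous/derivable1_diffP.
  by have [] := dE x.
rewrite (@continuous_FTC2 _ f (fun r => expR (k * (r - s)) / k))//.
- by rewrite -EFinB subrr mulr0 expR0 -mulrBl.
- exact: continuous_subspaceT.
- split; first by move=> x _; have [] := dE x.
  + exact/cvg_at_right_filter/cF.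
  + exact/cvg_at_left_filter/cF.
- by move=> x _; rewrite derive1E; have [_ ->] := dE x.
Qed.
Lemma integrable_leb_expR (R : realType) (k s t : R) : 0 < k -> s <= t ->
  leb.-integrable (`[s, t] : set (lebR R)) (fun r => (expR (k * (r - s)))%:E).
Proof.
move=> k0 st; apply/integrableP; split.
  apply/measurable_EFinP; apply: measurable_funTS.
  apply: (@measurableT_comp _ _ _ _ _ _ (fun r : R => expR (k * (r - s))) _
    (fun r : lebR R => r : R)); last exact: measurable_fun_leb.
  by apply: continuous_measurable_fun; exact: continuous_expR_affine.
under eq_integral do rewrite /= ger0_norm ?expR_ge0//.
by rewrite integral_leb_expR// ltry.
Qed.

Lemma measurable_leb_itv (R : realType) (s t : R) :
  measurable (`[s, t] : set (lebR R)).
Proof. exact: measurable_leb. Qed.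
#[local] Hint Extern 0 (measurable _) =>
  solve [exact: measurable_leb_itv] : core.

Lemma integrable_leb_cst (R : realType) (s t c : R) : s <= t ->
  leb.-integrable (`[s, t] : set (lebR R)) (fun=> c%:E).
Proof.
move=> st; apply/integrableP; split; first exact: measurable_cst.
by rewrite integral_cst//= [X in (_ * X)%E](leb_itv st) -EFinM ltry.
Qed.

(** * Stability of trajectories and of their cost *)

(** Gronwall's inequality, for a y that is the integral of w. Let M be the
    supremum of |y t| / e t with the weight e t = exp (2 L (t - s)). Integrating
    L M e over [s, t] gives at most M / 2 times e t, so that M is at most
    D (T - s) + M / 2, that is, M is at most 2 D (T - s). *)
Lemma gronwall_enorm (R : realType) (n : nat) (s T L D : R)
    (y w : R -> 'rV[R]_n) :
  0 < L -> 0 <= D ->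
  (forall i, leb.-integrable (`[s, T] : set (lebR R))
     (fun t => (w t ord0 i)%:E)) ->
  (forall t, t \in `[s, T] -> forall i,
     y t ord0 i = \int[leb]_(r in (`[s, t] : set (lebR R))) w r ord0 i) ->
  (forall t, t \in `[s, T] -> enorm (w t) <= D + L * enorm (y t)) ->
  forall t, t \in `[s, T] ->
    enorm (y t) <= 2 * D * (T - s) * expR (2 * L * (t - s)).
Proof.
move=> L0 D0 wi yE wy.
pose e t := expR (2 * L * (t - s)).
have e0 t : 0 < e t by exact: expR_gt0.
have L20 : 0 < 2 * L by rewrite mulr_gt0.
have e1 t : s <= t -> 1 <= e t.
  by move=> st; rewrite -expR0 ler_expR mulr_ge0 ?subr_ge0// ltW.
have sub t : t \in `[s, T] -> `[s, t]%classic `<=` `[s, T]%classic.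
  rewrite in_itv/= => /andP[st tT] r /=; rewrite !in_itv/= => /andP[-> rt].
  exact: le_trans rt tT.
have wit t i : t \in `[s, T] -> leb.-integrable (`[s, t] : set (lebR R))
    (fun r => (w r ord0 i)%:E).
  by move=> tsT; apply: integrableS (wi i) => //; exact: sub.
have improve M : (forall t, t \in `[s, T] -> enorm (y t) <= M * e t) ->
    forall t, t \in `[s, T] -> enorm (y t) <= (D * (T - s) + M / 2) * e t.
  move=> yM t tsT; have := tsT; rewrite in_itv/= => /andP[st tT].
  have M0 : 0 <= M.
    rewrite -(pmulr_lge0 _ (e0 t)); apply: le_trans (yM t tsT).
    exact: enorm_ge0.
  have ei : leb.-integrable (`[s, t] : set (lebR R))
      (fun r => (L * M * e r)%:E).
    by apply: integrable_scale => //; exact: integrable_leb_expR.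
  have ci := integrable_leb_cst D st.
  apply: (@le_trans _ _ (\int[leb]_(r in (`[s, t] : set (lebR R)))
      (D + L * M * e r))).
    apply: (@enorm_Rintegral_le _ _ _ leb _ _ w) => //.
    - by move=> i; exact: wit.
    - by move=> i; exact: yE.
    - by apply: (@eq_integrable _ _ _ leb _ _ _ _ _ (integrableD _ ci ei)).
    - move=> r str; have rsT : r \in `[s, T] by exact: sub str.
      apply: (le_trans (wy r rsT)); rewrite lerD2l -mulrA ler_pM2l//.
      exact: yM.
  rewrite RintegralD// Rintegral_cst// [X in fine X](leb_itv st).
  rewrite RintegralZl//; last exact: integrable_leb_expR.
  rewrite /Rintegral integral_leb_expR//= -/(e t).
  have -> : L * M * ((e t - 1) / (2 * L)) = M / 2 * e t - M / 2.
    by field; rewrite gt_eqF.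
  have : D * (t - s) <= D * (T - s) * e t.
    rewrite -mulrA ler_wpM2l//; apply: (@le_trans _ _ (T - s)).
      by rewrite lerD2r.
    by rewrite ler_peMr ?e1// subr_ge0 (le_trans st).
  lra.
(* A first, crude bound, which makes the supremum below finite. *)
pose B := \sum_(i < n) \int[leb]_(r in (`[s, T] : set (lebR R))) `|w r ord0 i|.
have yB t : t \in `[s, T] -> enorm (y t) <= B * e t.
  move=> tsT; have := tsT; rewrite in_itv/= => /andP[st tT].
  apply: (@le_trans _ _ B); last first.
    by rewrite ler_peMr ?e1// sumr_ge0// => i _; exact: Rintegral_ge0.
  apply: (le_trans (enorm_le_sum _)); apply: ler_sum => i _.
  rewrite yE//; apply: (le_trans (le_normr_Rintegral _ _)) => //.
    exact: wit.
  have awi A : leb.-integrable A (fun r => (w r ord0 i)%:E) ->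
      leb.-integrable A (fun r => `|w r ord0 i|%:E).
    by move=> wA; exact: (integrable_norm wA).
  rewrite /Rintegral fine_le//.
  - by apply: integrable_fin_num => //; exact: awi (wit _ _ tsT).
  - by apply: integrable_fin_num => //; exact: awi.
  - apply: ge0_subset_integral => //; last exact: sub.
    exact: (measurable_int leb (awi _ (wi i))).
pose Y := [set enorm (y t) / e t | t in `[s, T]].
have YM M : (forall t, t \in `[s, T] -> enorm (y t) <= M * e t) -> ubound Y M.
  by move=> yM _ [t tsT <-]; rewrite ler_pdivrMr// yM.
have ysup t : t \in `[s, T] -> enorm (y t) <= sup Y * e t.
  move=> tsT; rewrite -ler_pdivrMr//; apply: ub_le_sup; last by exists t.
  by exists B; exact: YM.
move=> t tsT; apply: (le_trans (ysup t tsT)); rewrite ler_pM2r//.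
have : sup Y <= D * (T - s) + sup Y / 2.
  by apply: ge_sup; [exists (enorm (y t) / e t); exists t|exact/YM/improve].
lra.
Qed.
Lemma traj_solution (R : realType) (n m : nat) (U : set 'rV[R]_m) (T : R)
    (g : 'rV[R]_n * set_type U -> 'rV[R]_n) (s : R) (x0 : 'rV[R]_n)
    (u : R -> set_type U) :
  well_posed T g -> s \in `[0, T] -> admissible T s u ->
  is_solution T g s x0 u (traj T g s x0 u).
Proof.
move=> wg sT uT; have [[x xP] _] := wg s x0 u sT uT.
by apply: xgetPex; exists x.
Qed.

(** The velocity gap splits as g (xg, u) - f (xf, u) =
    (g - f) (xg, u) + (f (xg, u) - f (xf, u)), so that the Lipschitz bound is
    asked of f only. *)
Lemma solution_stability (R : realType) (n m : nat) (U : set 'rV[R]_m)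
    (T L D : R) (g f : 'rV[R]_n * set_type U -> 'rV[R]_n) (s : R)
    (x0 : 'rV[R]_n) (u : R -> set_type U) (xg xf : R -> 'rV[R]_n) :
  0 < L -> 0 <= D ->
  (forall z, enorm (g z - f z) <= D) ->
  (forall x y v, enorm (f (x, v) - f (y, v)) <= L * enorm (x - y)) ->
  is_solution T g s x0 u xg -> is_solution T f s x0 u xf ->
  forall t, t \in `[s, T] ->
    enorm (xg t - xf t) <= 2 * D * (T - s) * expR (2 * L * (t - s)).
Proof.
move=> L0 D0 gfD fL [gi gE] [fi fE].
pose w r := g (xg r, u r) - f (xf r, u r).
apply: (@gronwall_enorm _ _ s T L D (fun t => xg t - xf t) w) => //.
- move=> i; rewrite (_ : (fun _ => _) =
    (fun t => (g (xg t, u t) ord0 i)%:E - (f (xf t, u t) ord0 i)%:E)%E).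
    exact: integrableB.
  by apply/funext => t; rewrite !mxE EFinB.
- move=> t tsT i; have st : `[s, t]%classic `<=` `[s, T]%classic.
    move: tsT; rewrite in_itv/= => /andP[_ tT] r /=.
    by rewrite !in_itv/= => /andP[-> rt]; exact: le_trans rt tT.
  rewrite !mxE gE// fE// opprD addrACA subrr add0r -RintegralB//.
  + by apply: eq_Rintegral => r _; rewrite !mxE.
  + exact: integrableS (gi i).
  + exact: integrableS (fi i).
- move=> t _.
  have -> : w t = (g (xg t, u t) - f (xg t, u t)) +
                  (f (xg t, u t) - f (xf t, u t)) by rewrite /w addrA subrK.
  by apply: (le_trans (ler_enormD _ _)); rewrite lerD.
Qed.

Lemma traj_cost_stability (R : realType) (n m : nat) (U : set 'rV[R]_m)
    (T L D Ll Lh : R) (l : 'rV[R]_n -> set_type U -> R) (h : 'rV[R]_n -> R)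
    (g f : 'rV[R]_n * set_type U -> 'rV[R]_n) (s : R)
    (x0 : 'rV[R]_n) (u : R -> set_type U) :
  0 < L -> 0 <= D ->
  (forall z, enorm (g z - f z) <= D) ->
  (forall x y v, enorm (f (x, v) - f (y, v)) <= L * enorm (x - y)) ->
  (forall x y v, `|l x v - l y v| <= Ll * enorm (x - y)) ->
  (forall x y, `|h x - h y| <= Lh * enorm (x - y)) ->
  well_posed T g -> well_posed T f ->
  s \in `[0, T] -> admissible T s u ->
  leb.-integrable (`[s, T] : set (lebR R)) (running_cost T l g s x0 u) ->
  leb.-integrable (`[s, T] : set (lebR R)) (running_cost T l f s x0 u) ->
  (`|traj_cost T l h g s x0 u - traj_cost T l h f s x0 u| <=
   ((`|Ll| * T + `|Lh|) * (2 * T * expR (2 * L * T)) * D)%:E)%E.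
Proof.
move=> L0 D0 gfD fL lL hL wg wf s0T uU ig jf.
have := s0T; rewrite in_itv/= => /andP[s0 sT].
have T0 : 0 <= T by exact: le_trans sT.
have xg := traj_solution x0 wg s0T uU; have xf := traj_solution x0 wf s0T uU.
set M := 2 * T * expR (2 * L * T) * D.
have dist t : t \in `[s, T] ->
    enorm (traj T g s x0 u t - traj T f s x0 u t) <= M.
  move=> tsT; apply: (le_trans (solution_stability L0 D0 gfD fL xg xf tsT)).
  move: tsT; rewrite in_itv/= => /andP[st tT].
  rewrite (_ : 2 * D * (T - s) * _ =
    2 * (T - s) * expR (2 * L * (t - s)) * D); last by ring.
  rewrite ler_wpM2r// ler_pM ?mulr_ge0 ?expR_ge0 ?subr_ge0//.
    by rewrite ler_pM2l// gerBl.
  by rewrite ler_expR ler_pM2l ?mulr_gt0//; lra.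
(* The sign of a Lipschitz constant is unknown in dimension 0, where the norm
   vanishes; whence the absolute values. *)
have lip a b t : b <= a * enorm (traj T g s x0 u t - traj T f s x0 u t) ->
    t \in `[s, T] -> b <= `|a| * M.
  move=> ba tsT; apply: (le_trans ba).
  apply: (@le_trans _ _ (`|a| * enorm (traj T g s x0 u t - traj T f s x0 u t))).
    by rewrite ler_wpM2r ?enorm_ge0// ler_norm.
  by rewrite ler_wpM2l// dist.
have TsT : T \in `[s, T] by rewrite in_itv/= sT lexx.
pose F x t := l (traj T x s x0 u t) (u t).
rewrite /traj_cost.
have E x :
  leb.-integrable (`[s, T] : set (lebR R)) (running_cost T l x s x0 u) ->
  (\int[leb]_(t in (`[s, T] : set (lebR R))) running_cost T l x s x0 u t =
   (\int[leb]_(t in (`[s, T] : set (lebR R))) F x t)%:E)%E.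
  by move=> ix; rewrite /Rintegral fineK//; exact: integrable_fin_num.
rewrite !E// -!EFinD lee_fin opprD addrACA -RintegralB//.
apply: (le_trans (ler_normD _ _)).
rewrite -mulrA -/M mulrDl; apply: lerD; last exact: (lip _ _ _ (hL _ _)).
have iB : leb.-integrable (`[s, T] : set (lebR R))
    (fun t => (F g t - F f t)%:E).
  by apply: (@eq_integrable _ _ _ leb _ _ _ _ _ (integrableB _ ig jf)).
apply: (le_trans (le_normr_Rintegral _ iB)) => //.
apply: (@le_trans _ _ (\int[leb]_(t in (`[s, T] : set (lebR R))) (`|Ll| * M))).
  apply: le_Rintegral => //.
  - exact: (integrable_norm iB).
  - exact: integrable_leb_cst.
  - by move=> t tsT; exact: (lip _ _ _ (lL _ _ _)).
rewrite Rintegral_cst// [X in fine X](leb_itv sT) mulrAC ler_wpM2r//=.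
  by rewrite !mulr_ge0// expR_ge0.
by rewrite ler_wpM2l// gerBl.
Qed.
(** * Costs averaged along a coupling *)

(** The function g may fail to be measurable: the integral of a nonnegative
    function is the supremum of the integrals of the simple functions below it,
    hence monotone. It is applied with the distance on X as g, which spares the
    comparison of the Borel sets of X * X with the product sigma-algebra. *)
Lemma ge0_le_integralT (d : measure_display) (S : measurableType d)
    (R : realType) (mu : {measure set S -> \bar R}) (f g : S -> \bar R) :
  (forall x, 0 <= f x)%E -> (forall x, f x <= g x)%E ->
  (\int[mu]_x f x <= \int[mu]_x g x)%E.
Proof.
move=> f0 fg; have g0 x : (0 <= g x)%E by exact: le_trans (fg x).
rewrite !ge0_integralTE//; apply: le_ereal_sup => _ [k kf <-].
by exists k => // x; exact: le_trans (fg x).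
Qed.

Lemma integral_marginal (d d' : measure_display) (S : measurableType d)
    (S' : measurableType d') (R : realType) (mu : {measure set S -> \bar R})
    (nu : {measure set S' -> \bar R}) (phi : S -> S') (c : S' -> \bar R) :
  measurable_fun [set: S] phi ->
  (forall A, measurable A -> mu (phi @^-1` A) = nu A) ->
  nu.-integrable [set: S'] c ->
  mu.-integrable [set: S] (c \o phi) /\
  (\int[nu]_y c y = \int[mu]_x c (phi x))%E.
Proof.
move=> mphi munu /integrableP[mc intc].
have eqint (k : S' -> \bar R) :
    (\int[nu]_y k y = \int[pushforward mu phi]_y k y)%E.
  by apply: eq_measure_integral => A mA _; rewrite -munu.
have icphi : mu.-integrable [set: S] (c \o phi).
  apply/integrableP; split; first exact: measurableT_comp.
  move: intc; rewrite eqint ge0_integral_pushforward//.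
  exact: measurableT_comp.
split=> //; rewrite eqint integral_pushforward//.
Qed.

Lemma sup_dist_ub (R : realType) (n m : nat) (U : set 'rV[R]_m)
    (g f : dynamics R n U) z :
  (sup_dist g f < +oo)%E -> enorm (g z - f z) <= fine (sup_dist g f).
Proof.
move=> gf; have le : ((enorm (g z - f z))%:E <= sup_dist g f)%E.
  by apply: ereal_sup_ubound; exists z.
rewrite -lee_fin fineK// fin_numElt gf andbT.
by apply: lt_le_trans le; rewrite ltNyr.
Qed.

(** Both averages are integrals of c against gamma, through either coordinate;
    their difference is the integral of c z.1 - c z.2, which is controlled by
    the distance off the gamma-null set of the z with z.2 outside S. *)
Lemma coupling_bound (R : realType) (n m : nat) (U : set 'rV[R]_m)
    (X : set (dynamics R n U)) (X0 : X !=set0)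
    (pi pi' : probability (borel X0) R)
    (gamma : probability (borel X0 * borel X0)%type R)
    (c : dyn_space X0 -> \bar R) (S : set (dyn_space X0)) (K : R) :
  0 < K -> couplings pi pi' gamma ->
  pi.-integrable [set: borel X0] c -> pi'.-integrable [set: borel X0] c ->
  pi'.-negligible (~` S) ->
  (forall g f, (0 <= sup_dist (dyn_fun X0 g) (dyn_fun X0 f))%E) ->
  (forall g f, S f ->
     (`|c g - c f| <= K%:E * sup_dist (dyn_fun X0 g) (dyn_fun X0 f))%E) ->
  (`|\int[pi]_g c g - \int[pi']_g c g| <=
   K%:E * \int[gamma]_z sup_dist (dyn_fun X0 z.1) (dyn_fun X0 z.2))%E.
Proof.
move=> K0 gammaP ic ic' [N [mN N0 SN]] d0 cd.
have g1 A : measurable A -> gamma (fst @^-1` A) = pi A.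
  by move=> mA; rewrite -setXT (gammaP A mA).1.
have g2 A : measurable A -> gamma (snd @^-1` A) = pi' A.
  by move=> mA; rewrite -setTX (gammaP A mA).2.
have [i1 ->] := integral_marginal (@measurable_fst _ _ _ _) g1 ic.
have [i2 ->] := integral_marginal (@measurable_snd _ _ _ _) g2 ic'.
rewrite -integralB//.
have i12 : gamma.-integrable setT (fun z => c z.1 - c z.2)%E.
  exact: integrableB.
apply: (@le_trans _ _ (\int[gamma]_z `|c z.1 - c z.2|)%E).
  exact: (le_abse_integral _ _ (measurable_int _ i12)).
have mabs : measurable_fun [set: (borel X0 * borel X0)%type]
    (fun z => `|c z.1 - c z.2|)%E.
  by apply: measurableT_comp => //; exact: (measurable_int _ i12).
have mN2 : measurable (snd @^-1` N : set (borel X0 * borel X0)%type).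
  by rewrite -[X in measurable X]setTI; exact: (@measurable_snd _ _ _ _).
rewrite (ge0_negligible_integral mN2)//; last exact: (eq_trans (g2 N mN) N0).
rewrite -lee_pdivrMl// -ge0_integralZl//; last 3 first.
- exact: measurableD.
- exact: measurable_funTS.
- by rewrite lee_fin invr_ge0 ltW.
rewrite integral_mkcond; apply: ge0_le_integralT => z.
  rewrite patchE; case: ifP => // _; rewrite mule_ge0// lee_fin invr_ge0 ltW//.
rewrite patchE; case: ifPn => [/set_mem[_ Nz]|_]; last exact: d0.
rewrite lee_pdivrMl//; apply: cd; apply: contrapT => Sz.
exact/Nz/SN.
Qed.
(** * Comparison of the value functions *)

Lemma le_ereal_infD (R : realType) (I : Type) (A : set I) (J J' : I -> \bar R)
    (r : R) :
  (forall u, A u -> J u <= J' u + r%:E)%E ->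
  (ereal_inf [set J u | u in A] <= ereal_inf [set J' u | u in A] + r%:E)%E.
Proof.
move=> JJ'; rewrite -leeBlDr//; apply: le_ereal_inf_tmp => _ [u Au <-].
rewrite leeBlDr//; apply: le_trans (JJ' u Au).
by apply: ereal_inf_lbound; exists u.
Qed.

Lemma abse_ereal_infB_le (R : realType) (I : Type) (A : set I)
    (J J' : I -> \bar R) (r : \bar R) :
  (forall u, A u -> J u \is a fin_num) ->
  (forall u, A u -> J' u \is a fin_num) ->
  ereal_inf [set J u | u in A] \is a fin_num ->
  ereal_inf [set J' u | u in A] \is a fin_num ->
  (forall u, A u -> `|J u - J' u| <= r)%E ->
  (`|ereal_inf [set J u | u in A] - ereal_inf [set J' u | u in A]| <= r)%E.
Proof.
move=> Jf J'f iJ iJ' JJ'.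
have [u0 Au0] : A !=set0.
  apply/set0P/eqP => A0; move: iJ.
  by rewrite A0 image_set0 ereal_inf0.
case: r JJ' => [r| |] JJ'; last 2 first.
- by rewrite leey.
- by have := le_trans (abse_ge0 _) (JJ' _ Au0).
have Jle u : A u -> (J u <= J' u + r%:E)%E /\ (J' u <= J u + r%:E)%E.
  move=> Au; have := JJ' u Au.
  rewrite -(fineK (Jf u Au)) -(fineK (J'f u Au)) -EFinB !lee_fin.
  by rewrite ler_norml => /andP[] ? ?; split; lra.
have h1 := le_ereal_infD (fun u Au => (Jle u Au).1).
have h2 := le_ereal_infD (fun u Au => (Jle u Au).2).
move: iJ iJ' h1 h2 => /fineK <- /fineK <-.
rewrite -!EFinD !lee_fin => h1 h2.
by rewrite ler_norml; apply/andP; split; lra.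
Qed.

Theorem mainTheorem1 (R : realType) :
  exists C : R -> R -> R -> R -> R,
  forall (n m : nat) (T Lf Ll Lh : R) (U : set 'rV[R]_m)
    (X : set (dynamics R n U)) (X0 : X !=set0)
    (piN pioo : probability (borel X0) R)
    (l : 'rV[R]_n -> set_type U -> R) (h : 'rV[R]_n -> R),
  0 < T -> closed U -> U !=set0 ->
  (forall g, X g -> continuous (g : 'rV[R]_n * set_type U -> 'rV[R]_n)) ->
  (forall g f, X g -> X f -> (sup_dist g f < +oo)%E) ->
  compact X ->
  (forall g : dyn_space X0, well_posed T (dyn_fun X0 g)) ->
  cost_well_defined piN T l h ->
  cost_well_defined pioo T l h ->
  (forall s x0, s \in `[0, T] -> value piN T l h s x0 \is a fin_num) ->
  (forall s x0, s \in `[0, T] -> value pioo T l h s x0 \is a fin_num) ->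
  0 < Lf ->
  (forall f, supp pioo f -> forall (x y : 'rV[R]_n) (u : set_type U),
     enorm (dyn_fun X0 f (x, u) - dyn_fun X0 f (y, u)) <= Lf * enorm (x - y)) ->
  (forall (x y : 'rV[R]_n) (u : set_type U),
     `|l x u - l y u| <= Ll * enorm (x - y)) ->
  (forall x y : 'rV[R]_n, `|h x - h y| <= Lh * enorm (x - y)) ->
  (sup_norm T (fun s x0 => value piN T l h s x0 - value pioo T l h s x0)
    <= (C Lf Ll Lh T)%:E * W1 piN pioo)%E.
Proof.
(* The summand 1 makes the constant positive, so that one can divide by it even
   when the transport cost of a coupling is infinite. *)
exists (fun Lf Ll Lh T =>
  (`|Ll| * T + `|Lh|) * (2 * T * expR (2 * Lf * T)) + 1).
move=> n m T Lf Ll Lh U X X0 piN pioo l h T0 _ [v0 Uv0] _ Xfin cX wp cN coo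
  vN voo Lf0 Lflip Llip Lhlip.
set K := (`|Ll| * T + `|Lh|) * (2 * T * expR (2 * Lf * T)).
have K0 : 0 <= K.
  by rewrite mulr_ge0 ?addr_ge0 ?mulr_ge0 ?expR_ge0 ?normr_ge0// ltW.
have K10 : 0 < K + 1 by rewrite ltr_wpDl.
apply: ge_ereal_sup => _ [[s x0] [/= sT _] <-].
rewrite -lee_pdivrMl//; apply: le_ereal_inf_tmp => _ [gamma gammaP <-].
rewrite lee_pdivrMl//.
have Xval (g : dyn_space X0) : X (dyn_fun X0 g) by exact/set_mem/(valP g).
pose z0 : 'rV[R]_n * set_type U := (x0, SigSub (mem_set Uv0)).
have d0 (g f : dyn_space X0) : (0 <= sup_dist (dyn_fun X0 g) (dyn_fun X0 f))%E.
  apply: (@le_trans _ _ (enorm (dyn_fun X0 g z0 - dyn_fun X0 f z0))%:E).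
    by rewrite lee_fin enorm_ge0.
  by apply: ereal_sup_ubound; exists z0.
apply: abse_ereal_infB_le; [| |exact: vN|exact: voo|].
- by move=> u uU; apply: integrable_fin_num => //; exact: (cN s x0 u sT uU).2.
- by move=> u uU; apply: integrable_fin_num => //; exact: (coo s x0 u sT uU).2.
move=> u uU; have [iN jN] := cN s x0 u sT uU; have [_ joo] := coo s x0 u sT uU.
apply: (coupling_bound K10 gammaP jN joo (compl_supp_negligible pioo cX) d0).
move=> g f suppf; have gf := Xfin _ _ (Xval g) (Xval f).
have dfin : sup_dist (dyn_fun X0 g) (dyn_fun X0 f) \is a fin_num.
  by rewrite ge0_fin_numE.
have D0 : 0 <= fine (sup_dist (dyn_fun X0 g) (dyn_fun X0 f)) by exact: fine_ge0.
have dist := traj_cost_stability Lf0 D0 (fun z => sup_dist_ub z gf)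
  (Lflip f suppf) Llip Lhlip (wp g) (wp f) sT uU (iN g) (iN f).
apply: le_trans dist _.
by rewrite -{2}(fineK dfin) -EFinM lee_fin ler_wpM2r// lerDl.
Qed.
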